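(* Let $\mathbb{F}$ be a field and let $v$ be an arbitrary vertex of a finite simplicial complex $K$. Then the simplicial wedge $K(v)$ is weakly taut over $\mathbb{F}$ if and only if $K$ is weakly taut over $\mathbb{F}$.
   Context: A finite simplicial complex $K$ with vertex set $V(K)=[m]=\{v_1,\dots,v_m\}$ contains $\varnothing$ and every singleton as a face. $K|_J$ is the full subcomplex on $J\subseteq V(K)$; $K\setminus v=K|_{V(K)\setminus\{v\}}$; $\mathrm{link}_K v=\{\tau\in K\mid\{v\}\cup\tau\in K,\ v\notin\tau\}$; $*$ is the join. The simplicial wedge of $K$ on the vertex $v$ is the simplicial complex with $m+1$ vertices $$K(v)=(\overline{v'v''}*\mathrm{link}_K v)\cup\big((v'\cup v'')*(K\setminus v)\big),$$ where $\overline{v'v''}$ is a $1$-simplex spanned by two new vertices $v',v''$, and $v'\cup v''$ is the complex consisting of these two points; thus $V(K(v))=(V(K)\setminus\{v\})\cup\{v',v''\}$. The dimension of a face $\sigma$ is $|\sigma|-1$; $\mathrm{mdim}(K)$ is the minimal dimension of the maximal simplices of $K$. $\widetilde{D}(K;\mathbb{F})=\dim_{\mathbb{F}}\mathrm{Tor}_{\mathbb{F}[v_1,\dots,v_m]}(\mathbb{F}[K],\mathbb{F})$, where $\mathbb{F}[K]$ is the Stanley-Reisner ring; equivalently (Hochster's formula) $\widetilde{D}(K;\mathbb{F})=\sum_{J\subseteq V(K)}\sum_{i\ge -1}\dim_{\mathbb{F}}\widetilde{H}_i(K|_J;\mathbb{F})$, where $\widetilde{H}_{-1}(\{\varnothing\};\mathbb{F})=\mathbb{F}$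 is the only nonzero reduced homology group of $\{\varnothing\}$. A complex $K$ is weakly taut over $\mathbb{F}$ if $\widetilde{D}(K;\mathbb{F})=2^{|V(K)|-\mathrm{mdim}(K)-1}$. *)

(* Defs.v *)
From HB Require Import structures.
From mathcomp Require Import all_boot all_order all_algebra.

Set Implicit Arguments.
Unset Strict Implicit.
Unset Printing Implicit Defensive.

Import GRing.Theory.
Local Open Scope ring_scope.

Section Complexes.

Variable V : finType.
Implicit Types (K L : {set {set V}}) (s t J : {set V}) (v : V).

Definition down_closed K : Prop :=
  forall s t, s \in K -> t \subset s -> t \in K.

(* The vertex set of K is the whole of V, hence the condition on singletons.
   Full subcomplexes and links are families over the same V; they satisfy
   only [set0 \in K] and [down_closed K]. *)
Definition is_complex K : Prop :=
  [/\ set0 \in K, forall v, [set v] \in K & down_closed K].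

Definition full_subcomplex K J : {set {set V}} := [set s in K | s \subset J].

Definition deletion K v : {set {set V}} := full_subcomplex K [set~ v].

Definition link K v : {set {set V}} :=
  [set t in K | (v |: t \in K) && (v \notin t)].

(* Used only for families whose vertex sets are disjoint. *)
Definition join K L : {set {set V}} := [set s :|: t | s in K, t in L].

Definition is_facet K s : bool := maxset (fun t => t \in K) s.

(* Truncated at 0 for the empty face, which is a facet only if V is empty. *)
Definition face_dim s : nat := #|s|.-1.

(* Every complex has a facet and all face dimensions are at most #|V|, so the
   default value #|V| does not affect the minimum. *)
Definition mdim K : nat := \big[minn/#|V|]_(s | is_facet K s) face_dim s.

End Complexes.

Section Homology.

Variables (F : fieldType) (V : finType).
Implicit Types (K : {set {set V}}) (s t J : {set V}).

(* The augmented oriented chains of the full simplex on V, the basis element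
   of a face being oriented by the enumeration order of V.  The empty face is
   a basis element, in degree -1. *)
Local Notation chain := {ffun {set V} -> F^o}.

Definition face_chain s : chain := [ffun t => (t == s)%:R].

Definition vertex_pos s (x : V) : nat :=
  #|[set y in s | (enum_rank y < enum_rank x)%N]|.

Definition face_boundary s : chain :=
  \sum_(x in s) (-1) ^+ vertex_pos s x *: face_chain (s :\ x).

Definition boundary_fun (c : chain) : chain :=
  \sum_(s : {set V}) c s *: face_boundary s.

Fact boundary_fun_is_linear : linear boundary_fun.
Proof.
move=> a c d; rewrite /boundary_fun scaler_sumr -big_split /=.
by apply: eq_bigr => s _; rewrite !ffunE scalerDl scalerA.
Qed.

HB.instance Definition _ :=
  GRing.isLinear.Build F chain chain _ boundary_fun boundary_fun_is_linear.

Definition boundary : 'End(chain) := linfun boundary_fun.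

(* Faces are graded by cardinality: [chains K k] is spanned by the faces of K
   with k vertices, that is, of dimension k - 1. *)
Definition chains K (k : nat) : {vspace chain} :=
  <<[seq face_chain s | s <- enum [set s in K | #|s| == k]]>>%VS.

Definition cycles K k : {vspace chain} := (chains K k :&: lker boundary)%VS.

Definition boundaries K k : {vspace chain} := (boundary @: chains K k.+1)%VS.

(* The dimension of the reduced homology group of K in degree k - 1; boundaries
   are cycles by [boundaries_sub_cycles]. *)
Definition rhomology_dim K k : nat := (\dim (cycles K k) - \dim (boundaries K k))%N.

(* The total dimension of Tor of the Stanley-Reisner ring, expressed by
   Hochster's formula.  Degrees i >= -1 correspond to k = i + 1, and there are
   no chains for k > #|V|. *)
Definition Dtilde K : nat :=
  (\sum_(J : {set V}) \sum_(k < #|V|.+1) rhomology_dim (full_subcomplex K J) k)%N.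

Definition weakly_taut K : Prop := Dtilde K = (2 ^ (#|V| - mdim K - 1))%N.

Lemma boundary_face s : boundary (face_chain s) = face_boundary s.
Proof.
rewrite lfunE /= /boundary_fun (bigD1 s) //= ffunE eqxx scale1r.
by rewrite big1 ?addr0 // => t /negPf ts; rewrite ffunE ts scale0r.
Qed.

Lemma vertex_pos_lt s x y : x \in s -> (enum_rank x < enum_rank y)%N ->
  vertex_pos s y = (vertex_pos (s :\ x) y).+1.
Proof.
move=> xs xy; rewrite /vertex_pos (cardsD1 x) !inE xs xy /= add1n.
congr (_.+1); apply: eq_card => z; rewrite !inE; by case: (z == x); rewrite ?andbF.
Qed.

Lemma vertex_pos_ge s x y : (enum_rank y <= enum_rank x)%N ->
  vertex_pos s y = vertex_pos (s :\ x) y.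
Proof.
move=> yx; apply: eq_card => z; rewrite !inE.
by case: eqP => [->|]; rewrite // ltnNge yx andbF.
Qed.

Lemma boundaryK s : boundary (face_boundary s) = 0.
Proof.
rewrite /face_boundary linear_sum /=.
under eq_bigr => x _ do rewrite linearZ /= boundary_face /face_boundary scaler_sumr.
pose G x y : chain := (-1) ^+ vertex_pos s x *:
  ((-1) ^+ vertex_pos (s :\ x) y *: face_chain (s :\ x :\ y)).
have -> : \sum_(x in s) \sum_(y in s :\ x) G x y =
  \sum_(x in s) \sum_(y in s | (enum_rank y < enum_rank x)%N) G x y +
  \sum_(x in s) \sum_(y in s | (enum_rank x < enum_rank y)%N) G x y.
  rewrite -big_split /=; apply: eq_bigr => x xs.
  rewrite (bigID (fun y => (enum_rank y < enum_rank x)%N)) /=.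
  congr (_ + _); apply: eq_bigl => y; rewrite !inE.
    by case: eqP => [->|]; rewrite ?ltnn ?andbF.
  rewrite -leqNgt leq_eqVlt; case: (eqVneq y x) => [->|yx]; first by rewrite ltnn !andbF.
  suff /negPf -> : nat_of_ord (enum_rank x) != enum_rank y by [].
  by apply: contra yx => /eqP /val_inj /enum_rank_inj ->.
rewrite (exchange_big_dep (mem s)) /=; last by move=> ? ? _ /andP[].
rewrite -big_split big1 //= => x xs.
rewrite (eq_bigl (fun y => (y \in s) && (enum_rank x < enum_rank y)%N)); last first.
  by move=> y; rewrite xs.
rewrite -big_split big1 //= => y /andP[ys xy].
rewrite /G !scalerA -!exprD (vertex_pos_lt xs xy) (vertex_pos_ge s (ltnW xy)).
have -> : s :\ y :\ x = s :\ x :\ y by rewrite !setDDl setUC.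
by rewrite addSn exprS addnC mulN1r scaleNr addNr.
Qed.

Lemma boundaries_sub_cycles K k : down_closed K ->
  (boundaries K k <= cycles K k)%VS.
Proof.
move=> dK; rewrite /boundaries /chains limg_span; apply/span_subvP => c.
case/mapP => _ /mapP[s + ->] ->; rewrite mem_enum inE => /andP[sK /eqP sk].
rewrite boundary_face memv_cap memv_ker boundaryK eqxx andbT.
apply: memv_suml => x xs; apply/memvZ/memv_span/map_f.
rewrite mem_enum inE (dK s) ?subD1set //=.
by move: sk; rewrite (cardsD1 x) xs add1n => -[->].
Qed.

End Homology.

Section Wedge.

Variable V : finType.
Implicit Types (K : {set {set V}}) (v : V).

(* The vertices of K(v) are the elements of [option V].  Since v is not a
   vertex of K(v), [Some v] is free to play the part of v', with [None] that of
   v'', and [Some x] that of any other vertex x of K. *)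
Definition wedge_lift K : {set {set option V}} := [set Some @: s | s : {set V} in K].

Definition wedge K v : {set {set option V}} :=
  let v' := Some v in let v'' := None in
  join (powerset [set v'; v'']) (wedge_lift (link K v))
  :|: join [set set0; [set v']; [set v'']] (wedge_lift (deletion K v)).

End Wedge.

Lemma join_down_closed (V : finType) (K L : {set {set V}}) :
  down_closed K -> down_closed L -> down_closed (join K L).
Proof.
move=> dK dL _ t /imset2P[a b aK bL ->] tab.
have -> : t = (t :&: a) :|: (t :&: b) by rewrite -setIUr; apply/esym/setIidPl.
by apply: imset2_f; [apply: dK aK _ | apply: dL bL _]; apply: subsetIr.
Qed.

Lemma wedge_lift_down_closed (V : finType) (K : {set {set V}}) :
  down_closed K -> down_closed (wedge_lift K).
Proof.
move=> dK _ t /imsetP[s sK ->] ts; apply/imsetP; exists (Some @^-1: t).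
  apply: dK sK _; apply/subsetP => x; rewrite inE => /(subsetP ts).
  by case/imsetP => y ys [->].
apply/setP => z; apply/idP/imsetP => [zt|[x]]; last by rewrite inE => ? ->.
by case/imsetP: (subsetP ts z zt) => x xs zx; exists x; rewrite ?inE -?zx.
Qed.

Lemma wedge_complex (V : finType) (K : {set {set V}}) (v : V) :
  is_complex K -> is_complex (wedge K v).
Proof.
move=> [K0 K1 dK].
have dl : down_closed (link K v).
  move=> s t; rewrite !inE => /and3P[sK vsK vs] ts.
  rewrite (dK s t sK ts) (dK _ _ vsK (setUS _ ts)) /=.
  exact: contra (subsetP ts v) vs.
have dd : down_closed (deletion K v).
  move=> s t; rewrite !inE => /andP[sK vs] ts.
  by rewrite (dK s t sK ts) (subset_trans ts vs).
have dp : down_closed [set set0; [set Some v]; [set None]].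
  move=> s t; rewrite !inE => /orP[/orP[]|] /eqP -> ts.
  - by rewrite subset0 in ts; rewrite ts.
  - by move: ts; rewrite subset1 => /orP[] ->; rewrite ?orbT.
  - by move: ts; rewrite subset1 => /orP[] ->; rewrite ?orbT.
have dq : down_closed (powerset [set Some v; None]).
  by move=> s t; rewrite !inE => /[swap]; apply: subset_trans.
have d0 : set0 \in wedge_lift (deletion K v).
  by apply/imsetP; exists set0; rewrite ?imset0 // !inE K0 sub0set.
split.
- apply/setUP; right; apply/imset2P; exists set0 set0; rewrite ?setU0 //.
  by rewrite !inE eqxx.
- move=> x; apply/setUP; right; case: x => [x|]; last first.
    by apply/imset2P; exists [set None] set0; rewrite ?setU0 // !inE eqxx !orbT.
  have [->|xv] := eqVneq x v.
    by apply/imset2P; exists [set Some v] set0; rewrite ?setU0 // !inE eqxx !orbT.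
  apply/imset2P; exists set0 [set Some x]; rewrite ?set0U // ?inE ?eqxx //.
  apply/imsetP; exists [set x]; last by rewrite imset_set1.
  by rewrite !inE K1 sub1set !inE.
- move=> s t /setUP[] sK ts; apply/setUP; [left|right].
    exact: join_down_closed dq (wedge_lift_down_closed dl) s t sK ts.
  exact: join_down_closed dp (wedge_lift_down_closed dd) s t sK ts.
Qed.

(* Main.v *)
From HB Require Import structures.
Require Import Defs.
From mathcomp Require Import all_boot all_order all_algebra.

(* Write W = K(v). A full subcomplex of W containing exactly one of v', v'' is a
   cone, hence acyclic; one containing neither is a full subcomplex K|_J with
   v \notin J; one containing both is (K|_J)(v) with v \in J. The chains of
   K(v) split as the image of the suspension c |-> (v'' - v') * c, on which the
   boundary is minus that of K, plus the chains of the faces avoiding v'', which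
   form a cone with apex v'. So the homology of K(v) is that of K shifted by one
   degree, and Hochster's sum gives the same total for W and K. The facets of W
   have one vertex more than the facets of K they come from, so
   mdim W = mdim K + 1, as does the number of vertices. *)

Set Implicit Arguments.
Unset Strict Implicit.
Unset Printing Implicit Defensive.

Import GRing.Theory.
Local Open Scope ring_scope.

(** With [X] and [Y] the chains of two consecutive degrees this is convertible to [rhomology_dim].
    Arbitrary subspaces allow the chains to be cut into summands. *)
Definition hdim (F : fieldType) (U : vectType F) (f : 'End(U)) (X Y : {vspace U}) : nat :=
  (\dim (X :&: lker f) - \dim (f @: Y))%N.

(** * Homology dimensions of subspaces under an endomorphism *)

Section HomologyOfSubspaces.

Variables (F : fieldType) (U : vectType F).
Implicit Types (f h : 'End(U)) (X Y : {vspace U}).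

(** An injection that commutes with the differentials up to a unit carries cycles onto cycles and
    boundaries onto boundaries. The unit [a] is there for the suspension, which anticommutes with
    the boundary. *)
Lemma hdim_img (U' : vectType F) f (f' : 'End(U')) (g : 'Hom(U, U')) (a : F) X Y :
  lker g == 0%VS -> a != 0 -> (forall u, f' (g u) = a *: g (f u)) ->
  hdim f' (g @: X) (g @: Y) = hdim f X Y.
Proof.
move=> g0 a0 fg.
have dimg Z : \dim (g @: Z) = \dim Z.
  by apply: limg_dim_eq; rewrite (eqP g0) capv0.
rewrite /hdim -(dimg (X :&: _)%VS) -(dimg (f @: Y)%VS); congr subn; congr (dimv _).
  apply/vspaceP => w; apply/memv_capP/memv_imgP => [[/memv_imgP[u uX ->]]|[u]].
    rewrite memv_ker fg scaler_eq0 (negPf a0) /= -memv_ker (eqP g0) memv0 => /eqP fu.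
    by exists u; rewrite // memv_cap uX memv_ker fu eqxx.
  case/memv_capP => uX; rewrite memv_ker => /eqP fu ->.
  by rewrite memv_img // memv_ker fg fu linear0 scaler0.
apply/vspaceP => w; apply/memv_imgP/memv_imgP => [[_ /memv_imgP[u uY ->] ->]|].
  by exists (f (a *: u)); rewrite ?memv_img ?memvZ // linearZ /= linearZ /= fg.
case=> _ /memv_imgP[u uY ->] ->; exists (g (a^-1 *: u)).
  by rewrite memv_img ?memvZ.
by rewrite fg !linearZ /= scalerA mulVf // scale1r.
Qed.

(** The map [h] is a contracting homotopy: a cycle [u] equals [f (h u)], hence is a boundary. *)
Lemma hdim_contractible f h X Y :
  (forall u, f (h u) + h (f u) = u) -> (h @: X <= Y)%VS -> hdim f X Y = 0%N.
Proof.
move=> fh hXY; apply/eqP; rewrite subn_eq0; apply/dimvS/subvP => u.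
rewrite memv_cap memv_ker => /andP[uX /eqP fu].
by rewrite -[u]fh fu linear0 addr0 memv_img // (subvP hXY) // memv_img.
Qed.

(** Disjointness of the images forces both components of a cycle to be cycles. The two inclusions
    make the boundary spaces disjoint and keep the subtractions from truncating. *)
Lemma hdim_add f X1 X2 Y1 Y2 :
  (X1 :&: X2 = 0)%VS -> (f @: X1 :&: f @: X2 = 0)%VS ->
  (f @: Y1 <= X1 :&: lker f)%VS -> (f @: Y2 <= X2 :&: lker f)%VS ->
  hdim f (X1 + X2) (Y1 + Y2) = (hdim f X1 Y1 + hdim f X2 Y2)%N.
Proof.
move=> X12 fX12 sY1 sY2; rewrite /hdim limgD.
have cap0 (Z1 Z2 : {vspace U}) : (Z1 <= X1)%VS -> (Z2 <= X2)%VS ->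
    (Z1 :&: Z2 = 0)%VS.
  by move=> s1 s2; apply/eqP; rewrite -subv0 -X12 capvS.
rewrite [in X in (_ - X)%N]dimv_disjoint_sum; last first.
  by apply: cap0; [apply: subv_trans sY1 _ | apply: subv_trans sY2 _]; apply: capvSl.
have -> : ((X1 + X2) :&: lker f = X1 :&: lker f + X2 :&: lker f)%VS.
  apply/vspaceP => u; apply/idP/idP; last first.
    by apply/subvP; rewrite subv_cap addvS ?capvSl //= subv_add !capvSr.
  case/memv_capP=> /memv_addP[x1 x1X [x2 x2X ->]].
  rewrite memv_ker linearD /= addr_eq0 => /eqP fx.
  have f1 : f x1 = 0.
    apply/eqP; rewrite -memv0 -fX12 memv_cap memv_img //=.
    by rewrite fx memvN memv_img.
  have f2 : f x2 = 0 by apply/eqP; rewrite -oppr_eq0 -fx f1.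
  by apply: memv_add; rewrite memv_cap memv_ker ?f1 ?f2 eqxx andbT.
rewrite dimv_disjoint_sum; last by rewrite cap0 ?capvSl.
have le1 := dimvS sY1; have le2 := dimvS sY2.
by rewrite addnBA // addnBAC // -subnDA.
Qed.

End HomologyOfSubspaces.

(** * Chains, linear extension from faces, and cones *)

Section Chains.

Variables (F : fieldType) (V : finType).
Implicit Types (K : {set {set V}}) (s t : {set V}).

Local Notation chain V := {ffun {set V} -> F^o}.
Local Notation "[ s ]f" := (face_chain F s) (format "[ s ]f").

Lemma face_chain_sum (c : chain V) : c = \sum_s c s *: [s]f.
Proof.
apply/ffunP => t; rewrite sum_ffunE (bigD1 t) //= !ffunE eqxx.
rewrite big1 ?addr0 ?[_ *: _]mulr1 // => s st.
by rewrite !ffunE eq_sym (negPf st) scaler0.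
Qed.

Section LinearExtension.

Variables (U : vectType F) (g : {set V} -> U).

Definition face_ext_fun (c : chain V) : U := \sum_s c s *: g s.

Fact face_ext_is_linear : linear face_ext_fun.
Proof.
move=> a c d; rewrite /face_ext_fun scaler_sumr -big_split /=.
by apply: eq_bigr => s _; rewrite !ffunE scalerDl scalerA.
Qed.

HB.instance Definition _ :=
  GRing.isLinear.Build F (chain V) U _ face_ext_fun face_ext_is_linear.

Definition face_ext : 'Hom(chain V, U) := linfun face_ext_fun.

Lemma face_extE s : face_ext [s]f = g s.
Proof.
rewrite lfunE /= /face_ext_fun (bigD1 s) //= ffunE eqxx scale1r.
by rewrite big1 ?addr0 // => t /negPf ts; rewrite ffunE ts scale0r.
Qed.

End LinearExtension.

Lemma hom_face_ext (U : vectType F) (f g : 'Hom(chain V, U)) :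
  (forall s, f [s]f = g [s]f) -> f =1 g.
Proof.
move=> fg c; rewrite (face_chain_sum c) !linear_sum /=.
by apply: eq_bigr => s _; rewrite !linearZ /= fg.
Qed.

Lemma mem_chains K k s : s \in K -> #|s| = k -> [s]f \in chains F K k.
Proof.
move=> sK sk; apply/memv_span/mapP; exists s => //.
by rewrite mem_enum inE sK sk eqxx.
Qed.

Lemma limg_chains_sub (U : vectType F) (g : 'Hom(chain V, U)) K k (X : {vspace U}) :
  (forall s, s \in K -> #|s| = k -> g [s]f \in X) -> (g @: chains F K k <= X)%VS.
Proof.
move=> gX; rewrite limg_span; apply/span_subvP => _ /mapP[_ /mapP[s + ->] ->].
by rewrite mem_enum inE => /andP[sK /eqP]; apply: gX.
Qed.

Lemma chains_sub K k (X : {vspace chain V}) :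
  (forall s, s \in K -> #|s| = k -> [s]f \in X) -> (chains F K k <= X)%VS.
Proof.
move=> sX; apply/span_subvP => _ /mapP[s + ->].
by rewrite mem_enum inE => /andP[sK /eqP]; apply: sX.
Qed.

Lemma boundary_boundary (c : chain V) : boundary F V (boundary F V c) = 0.
Proof.
rewrite (face_chain_sum c) !linear_sum big1 //= => s _.
by rewrite !linearZ /= boundary_face boundaryK scaler0.
Qed.

Lemma boundary_chains K k : down_closed K ->
  (boundary F V @: chains F K k.+1 <= chains F K k :&: lker (boundary F V))%VS.
Proof. exact: boundaries_sub_cycles. Qed.

(* Exterior multiplication by the vertex w on the left. *)
Definition cone (w : V) : 'End(chain V) :=
  face_ext (fun s => if w \in s then 0 else (-1) ^+ vertex_pos s w *: [w |: s]f).

(** Deleting [w] after inserting it gives the face back; deleting any other vertex anticommutes with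
    inserting [w]. *)
Lemma boundary_cone w (c : chain V) :
  boundary F V (cone w c) + cone w (boundary F V c) = c.
Proof.
suff /(_ c) : ((boundary F V \o cone w) + (cone w \o boundary F V))%VF =1 \1%VF.
  by rewrite add_lfunE !comp_lfunE id_lfunE.
apply: hom_face_ext => s; rewrite add_lfunE !comp_lfunE id_lfunE.
rewrite face_extE boundary_face /face_boundary.
rewrite linear_sum /=; under [X in _ + X]eq_bigr => x _ do
  rewrite linearZ /= face_extE.
case: ifPn => ws.
  (* When [w] lies in [s], only the term that deletes [w] survives, since [cone w] kills every face
     containing [w]. *)
  rewrite linear0 add0r (bigD1 w) //= !inE eqxx /= scalerA setD1K //.
  rewrite -(vertex_pos_ge s (leqnn (enum_rank w))) -expr2 sqrr_sign scale1r.
  by rewrite big1 ?addr0 // => x /andP[_ xw]; rewrite !inE eq_sym xw ws scaler0.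
rewrite linearZ /= boundary_face /face_boundary (big_setD1 w) ?setU11 //=.
rewrite setU1K // scalerDr scalerA.
rewrite (vertex_pos_ge (w |: s) (leqnn (enum_rank w))) setU1K //.
rewrite -expr2 sqrr_sign scale1r -addrA.
rewrite scaler_sumr -big_split big1 ?addr0 //= => x xs.
have xw : x != w by apply: contraNneq ws => <-.
rewrite !inE eq_sym (negPf xw) (negPf ws) /= !scalerA.
have -> : (w |: s) :\ x = w |: s :\ x.
  apply/setP => y; rewrite !inE; case: (eqVneq y w) => [->|] //=.
  by rewrite eq_sym xw.
rewrite -!exprD -scalerDl.
(* Exactly one of the two positions changes, by one, according to which of [x] and [w] comes first;
   the signs are therefore opposite. *)
have [lt|] := ltnP (enum_rank x) (enum_rank w).
  rewrite (vertex_pos_lt xs lt) (vertex_pos_ge (w |: s) (ltnW lt)) setU1K //.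
  by rewrite addSn exprS addnC mulN1r addNr scale0r.
rewrite leq_eqVlt => /orP[/eqP /val_inj /enum_rank_inj wx|lt].
  by rewrite wx eqxx in xw.
rewrite (vertex_pos_lt (setU11 w s) lt) setU1K //.
rewrite (vertex_pos_ge s (ltnW lt)).
by rewrite addnS exprS addnC mulN1r addNr scale0r.
Qed.

Lemma cone_chains K k w :
  (forall s, s \in K -> w \notin s -> w |: s \in K) ->
  (cone w @: chains F K k <= chains F K k.+1)%VS.
Proof.
move=> wK; apply: limg_chains_sub => s sK sk; rewrite face_extE.
case: ifPn => ws; first exact: mem0v.
by apply/memvZ/mem_chains; [apply: wK | rewrite cardsU1 ws sk].
Qed.

(** Exterior multiplication by the apex [w] maps chains of [K] to chains of [K], and so is a
    contracting homotopy. *)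
Lemma rhomology_dim_cone K k w :
  (forall s, s \in K -> w \notin s -> w |: s \in K) -> rhomology_dim F K k = 0%N.
Proof.
move=> wK; apply: (hdim_contractible (boundary_cone w)).
exact: cone_chains.
Qed.

(** Disposes of the additional top degree in the Hochster sum of K(v), which has one more vertex. *)
Lemma rhomology_dim_large K k : (#|V| < k)%N -> rhomology_dim F K k = 0%N.
Proof.
move=> Vk; rewrite /rhomology_dim /cycles.
suff -> : chains F K k = 0%VS by rewrite cap0v dimv0 sub0n.
apply/eqP; rewrite -subv0; apply: chains_sub => s _ sk.
by move: (max_card s); rewrite sk leqNgt Vk.
Qed.

End Chains.

(** * Vertex sets of K(v) and membership in the wedge *)

Section OptionSets.

Variable V : finType.
Implicit Types (s t J : {set V}) (x : V).

Lemma mem_imset_Some s x : (Some x \in Some @: s) = (x \in s).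
Proof. exact/mem_imset/Some_inj. Qed.

Lemma None_notin_imset s : None \notin Some @: s.
Proof. by apply/imsetP => -[]. Qed.

Lemma preimset_imset_Some s : Some @^-1: (Some @: s) = s.
Proof. by apply/setP => x; rewrite inE mem_imset_Some. Qed.

Lemma preimset_setU1_None s : Some @^-1: (None |: Some @: s) = s.
Proof. by apply/setP => x; rewrite !inE mem_imset_Some. Qed.

Lemma imset_preimset_Some (A : {set option V}) :
  None \notin A -> Some @: (Some @^-1: A) = A.
Proof.
move=> nA; apply/setP => -[x|]; first by rewrite mem_imset_Some inE.
by rewrite (negPf nA) (negPf (None_notin_imset _)).
Qed.

Lemma setU1_None_preimset (A : {set option V}) :
  None \in A -> None |: Some @: (Some @^-1: A) = A.
Proof. by move=> nA; apply/setP => -[x|]; rewrite !inE ?mem_imset_Some ?inE. Qed.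

Variant option_set_spec : {set option V} -> Prop :=
| OptionSetSome s : option_set_spec (Some @: s)
| OptionSetNone s : option_set_spec (None |: Some @: s).

Lemma option_setP (A : {set option V}) : option_set_spec A.
Proof.
have [nA|nA] := boolP (None \in A).
  by rewrite -(setU1_None_preimset nA); constructor.
by rewrite -(imset_preimset_Some nA); constructor.
Qed.

Lemma imset_Some_sub s t : (Some @: s \subset Some @: t) = (s \subset t).
Proof.
apply/idP/idP => [st|]; last exact: imsetS.
by rewrite -(preimset_imset_Some s) -(preimset_imset_Some t) preimsetS.
Qed.

Lemma imset_Some_subU1 s t : (Some @: s \subset None |: Some @: t) = (s \subset t).
Proof.
apply/idP/idP => [/(preimsetS Some)|st].
  by rewrite preimset_imset_Some preimset_setU1_None.
by apply: subset_trans (subsetU1 _ _); apply: imsetS.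
Qed.

Lemma setU1_None_sub s t :
  (None |: Some @: s \subset None |: Some @: t) = (s \subset t).
Proof. by rewrite subUset sub1set setU11 imset_Some_subU1. Qed.

Lemma setU1_None_sub_imset s t : (None |: Some @: s \subset Some @: t) = false.
Proof. by rewrite subUset sub1set (negPf (None_notin_imset t)). Qed.

Lemma card_imset_Some s : #|Some @: s| = #|s|.
Proof. exact/card_imset/Some_inj. Qed.

Lemma card_setU1_None s : #|None |: Some @: s| = #|s|.+1.
Proof. by rewrite cardsU1 None_notin_imset card_imset_Some. Qed.

(** Pairs the sets that differ only in [None], as Hochster's sum requires. *)
Lemma sum_option_set (f : {set option V} -> nat) :
  (\sum_A f A = \sum_(s : {set V}) (f (Some @: s) + f (None |: Some @: s)))%N.
Proof.
rewrite big_split (bigID (fun A : {set option V} => None \notin A)) /=; congr (_ + _)%N.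
  rewrite (reindex_onto (fun s : {set V} => Some @: s) (fun A => Some @^-1: A)) /=; last first.
    by move=> A; apply: imset_preimset_Some.
  by apply: eq_bigl => s; rewrite None_notin_imset preimset_imset_Some eqxx.
rewrite (reindex_onto (fun s : {set V} => None |: Some @: s) (fun A => Some @^-1: A)) /=.
  by apply: eq_bigl => s; rewrite setU11 preimset_setU1_None eqxx.
by move=> A; rewrite negbK; apply: setU1_None_preimset.
Qed.

Lemma enum_rank_index (T : finType) (x : T) : enum_rank x = index x (enum T) :> nat.
Proof.
by rewrite -[in RHS](nth_enum_rank x x) index_uniq ?enum_uniq // -cardE.
Qed.

(** The enumeration of [option V] starts with [None], so [Some] preserves the order of vertices and
    hence the signs in the boundary. *)
Lemma enum_rank_Some x : enum_rank (Some x) = (enum_rank x).+1 :> nat.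
Proof.
rewrite !enum_rank_index.
have -> : enum {: option V} = None :: map Some (enum V).
  by rewrite !enumT [in LHS]unlock.
by rewrite /= index_map //; apply: Some_inj.
Qed.

Lemma vertex_pos_Some s x : vertex_pos (Some @: s) (Some x) = vertex_pos s x.
Proof.
rewrite /vertex_pos -[RHS]card_imset_Some; apply: eq_card => -[y|].
  by rewrite inE !mem_imset_Some inE !enum_rank_Some ltnS.
by rewrite inE (negPf (None_notin_imset _)) (negPf (None_notin_imset _)).
Qed.

Section Wedge.

Variables (K : {set {set V}}) (v : V).
Hypothesis dK : down_closed K.

(** The faces avoiding [v''] form the cone with apex [v'] over the deletion of [v], which contains
    the link. *)
Lemma mem_wedge_Some s : (Some @: s \in wedge K v) = (s :\ v \in K).
Proof.
apply/idP/idP => [/setUP[]|sK].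
- case/imset2P=> a _ + /imsetP[t + ->] sat; rewrite !inE => av /and3P[tK _ _].
  apply: dK tK _; apply/subsetP => x /setD1P[xv].
  rewrite -mem_imset_Some sat inE mem_imset_Some => /orP[/(subsetP av)|//].
  by rewrite !inE orbF => /eqP[xv']; rewrite xv' eqxx in xv.
- case/imset2P=> a _ + /imsetP[t + ->] sat; rewrite !inE => av /andP[tK _].
  apply: dK tK _; apply/subsetP => x /setD1P[xv].
  rewrite -mem_imset_Some sat inE mem_imset_Some => /orP[xa|//].
  case/orP: av xa => [/orP[]|] /eqP ->; rewrite !inE // => /eqP[xv'].
  by rewrite xv' eqxx in xv.
apply/setUP; right; apply/imset2P.
exists (if v \in s then [set Some v] else set0) (Some @: (s :\ v)).
- by case: ifP; rewrite !inE eqxx ?orbT.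
- by apply: imset_f; rewrite !inE sK setDE subsetIr.
case: ifPn => vs; first by rewrite -imsetU1 setD1K.
by rewrite set0U (setDidPl _) // disjoint_sym disjoints1.
Qed.

(** Once [v''] is present, [v'] plays the part of [v]: faces with [v'] come from the link and faces
    without it from the deletion. The link of [v''] is thus a copy of [K]. *)
Lemma mem_wedge_None s : (None |: Some @: s \in wedge K v) = (s \in K).
Proof.
have memN x : (Some x \in None |: Some @: s) = (x \in s).
  by rewrite !inE mem_imset_Some.
apply/idP/idP => [/setUP[]|sK].
- case/imset2P=> a _ + /imsetP[t + ->] sat; rewrite !inE => av /and3P[_ tK _].
  apply: dK tK _; apply/subsetP => x; rewrite -memN sat !inE mem_imset_Some.
  by case/orP=> [/(subsetP av)|->]; rewrite ?orbT // !inE orbF => /eqP[->]; rewrite eqxx.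
- case/imset2P=> a _ + /imsetP[t + ->] sat; rewrite !inE => av /andP[tK _].
  have aN : None \in a.
    by have := setU11 None (Some @: s); rewrite sat inE (negPf (None_notin_imset t)) orbF.
  have {}av : a = [set None].
    by case/orP: av aN => [/orP[]|] /eqP ->; rewrite // !inE.
  by apply: dK tK _; apply/subsetP => x; rewrite -memN sat av !inE mem_imset_Some.
have [vs|vs] := boolP (v \in s); apply/setUP; [left|right]; apply/imset2P.
  exists [set Some v; None] (Some @: (s :\ v)).
  - by rewrite inE.
  - apply: imset_f; rewrite !inE eqxx setD1K // sK andbT.
    by rewrite (dK sK) ?subD1set.
  by rewrite [_ |: [set None]]setUC -setUA -imsetU1 setD1K.
exists [set None] (Some @: s) => //; first by rewrite !inE eqxx orbT.
by apply: imset_f; rewrite !inE sK subsetC sub1set inE.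
Qed.

End Wedge.

End OptionSets.

(** * The suspension map and the homology of K(v) *)

Section Suspension.

Variables (F : fieldType) (V : finType).
Implicit Types (K : {set {set V}}) (s : {set V}) (t : {set option V}) (v : V).

Local Notation chain V := {ffun {set V} -> F^o}.
Local Notation "[ s ]f" := (face_chain F s) (format "[ s ]f").

Definition lift_chain : 'Hom(chain V, chain (option V)) :=
  face_ext (fun s => [Some @: s]f).

Lemma boundary_lift (c : chain V) :
  boundary F _ (lift_chain c) = lift_chain (boundary F V c).
Proof.
rewrite -!comp_lfunE; move: c; apply: hom_face_ext => s.
rewrite !comp_lfunE face_extE !boundary_face /face_boundary.
rewrite linear_sum big_imset /=; last by move=> x y _ _ [].
apply: eq_bigr => x xs; rewrite linearZ /= face_extE vertex_pos_Some.
congr (_ *: face_chain _ _); apply/setP => -[y|]; rewrite !inE.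
  by rewrite !mem_imset_Some !inE.
by rewrite !(negPf (None_notin_imset _)).
Qed.

Lemma limg_lift_chains K k :
  (lift_chain @: chains F K k = chains F (wedge_lift K) k)%VS.
Proof.
apply/eqP; rewrite eqEsubv; apply/andP; split.
  apply: limg_chains_sub => s sK sk; rewrite face_extE.
  by apply: mem_chains; [apply: imset_f | rewrite card_imset_Some].
apply: chains_sub => _ /imsetP[s sK ->]; rewrite card_imset_Some => sk.
by rewrite -(face_extE (fun s : {set V} => [Some @: s]f)) memv_img // mem_chains.
Qed.

Lemma rhomology_dim_lift K k :
  rhomology_dim F (wedge_lift K) k = rhomology_dim F K k.
Proof.
rewrite /rhomology_dim /cycles /boundaries -!limg_lift_chains.
apply: (hdim_img (a := 1)) => [||c]; rewrite ?oner_neq0 ?scale1r ?boundary_lift //.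
(* Pulling faces back along [Some] is a left inverse of [lift_chain]. *)
apply/lker0P; apply: (can_inj (g := face_ext (fun t : {set option V} => [Some @^-1: t]f))) => c.
rewrite -comp_lfunE -[RHS]id_lfunE; move: c; apply: hom_face_ext => s.
by rewrite comp_lfunE !face_extE preimset_imset_Some id_lfunE.
Qed.

(* The suspension [c |-> (v'' - v') * c], where [v' = Some v], [v'' = None]. *)
Definition suspension v : 'Hom(chain V, chain (option V)) :=
  ((cone F None \o lift_chain) - (cone F (Some v) \o lift_chain))%VF.

Lemma suspensionE v c :
  suspension v c = cone F None (lift_chain c) - cone F (Some v) (lift_chain c).
Proof. by rewrite add_lfunE opp_lfunE !comp_lfunE. Qed.

(** By [boundary_cone], each of the two cones contributes one copy of [lift_chain c], and these
    copies cancel. *)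
Lemma boundary_suspension v c :
  boundary F _ (suspension v c) = - suspension v (boundary F V c).
Proof.
rewrite !suspensionE linearB /= -!boundary_lift.
have E w : boundary F _ (cone F w (lift_chain c)) =
    lift_chain c - cone F w (boundary F _ (lift_chain c)).
  by rewrite -[in X in X - _](boundary_cone w (lift_chain c)) addrK.
by rewrite !E !opprB addrC addrA subrK.
Qed.

(** Contraction against [v'']: a left inverse of the suspension that kills the chains avoiding
    [v'']. *)
Definition None_part : 'Hom(chain (option V), chain V) :=
  face_ext (fun t => if None \in t then [Some @^-1: t]f else 0).

Lemma suspension_face v s :
  suspension v [s]f = [None |: Some @: s]f - cone F (Some v) [Some @: s]f.
Proof.
rewrite suspensionE !face_extE (negPf (None_notin_imset s)); congr (_ - _).
(* [None] comes first in the enumeration, so inserting it costs no sign. *)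
have -> : vertex_pos (Some @: s) None = 0%N; last by rewrite scale1r.
have rN : enum_rank (None : option V) = 0%N :> nat.
  by rewrite enum_rank_index enumT [in LHS]unlock.
by apply: eq_card0 => x; rewrite inE rN ltn0 andbF.
Qed.

Lemma None_part_suspension v : cancel (suspension v) None_part.
Proof.
move=> c; rewrite -comp_lfunE -[RHS]id_lfunE; move: c; apply: hom_face_ext => s.
rewrite comp_lfunE id_lfunE suspension_face linearB /= !face_extE setU11.
rewrite preimset_setU1_None mem_imset_Some; case: ifP => _.
  by rewrite linear0 subr0.
rewrite linearZ /= face_extE -imsetU1 (negPf (None_notin_imset _)).
by rewrite scaler0 subr0.
Qed.

Lemma suspension_capv_chains v (L : {set {set option V}}) k :
  (forall t, t \in L -> None \notin t) ->
  (limg (suspension v) :&: chains F L k = 0)%VS.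
Proof.
move=> LN; apply/eqP; rewrite -subv0; apply/subvP => _ /memv_capP[/memv_imgP[c _ ->]].
have sL : (chains F L k <= lker None_part)%VS.
  apply: chains_sub => t tL _.
  by rewrite memv_ker face_extE (negPf (LN t tL)).
move=> /(subvP sL); rewrite memv_ker None_part_suspension => /eqP ->.
by rewrite linear0 mem0v.
Qed.

Section WedgeHomology.

Variables (K : {set {set V}}) (v : V).
Hypothesis dK : down_closed K.

(* The part of K(v) not containing v''; it is a cone with apex v'. *)
Let base := [set t in wedge K v | None \notin t].

Lemma base_Some s : (Some @: s \in base) = (s :\ v \in K).
Proof. by rewrite inE None_notin_imset andbT mem_wedge_Some. Qed.

Lemma base_cone t : t \in base -> Some v \notin t -> Some v |: t \in base.
Proof.
case/option_setP: t => s; last by rewrite inE setU11 andbF.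
by rewrite -imsetU1 !base_Some setDUl setDv set0U.
Qed.

Lemma down_closed_base : down_closed base.
Proof.
move=> t u; case/option_setP: t => s; last by rewrite inE setU11 andbF.
case/option_setP: u => s'; last by rewrite setU1_None_sub_imset.
rewrite !base_Some imset_Some_sub => sK ss; apply: dK sK _; exact: setSD.
Qed.

(** A face [None |: Some @: s] differs from the suspension of [s] by a chain of [base], the cone
    over [s] with apex [v']. *)
Lemma chains_wedgeS k :
  chains F (wedge K v) k.+1 = (suspension v @: chains F K k + chains F base k.+1)%VS.
Proof.
have cone_base s : s \in K -> #|s| = k ->
    cone F (Some v) [Some @: s]f \in chains F base k.+1.
  move=> sK sk; apply/(subvP (cone_chains F k base_cone))/memv_img/mem_chains.
    by rewrite base_Some (dK sK) ?subD1set.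
  by rewrite card_imset_Some.
apply/eqP; rewrite eqEsubv subv_add; apply/and3P; split.
- apply: chains_sub => t; case/option_setP: t => s.
    rewrite mem_wedge_Some // => sK sk; rewrite -[X in X \in _]add0r.
    by rewrite memv_add ?mem0v // mem_chains // base_Some.
  rewrite mem_wedge_None // card_setU1_None => sK [sk].
  rewrite -[X in X \in _](subrK (cone F (Some v) [Some @: s]f)).
  by rewrite -suspension_face memv_add ?cone_base // memv_img // mem_chains.
- apply: limg_chains_sub => s sK sk; rewrite suspension_face.
  apply: memvB; first by rewrite mem_chains ?mem_wedge_None ?card_setU1_None ?sk.
  apply: subvP (cone_base s sK sk); apply: chains_sub => t.
  by rewrite inE => /andP[tK _]; apply: mem_chains.
- by apply: chains_sub => t; rewrite inE => /andP[tK _]; apply: mem_chains.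
Qed.

Lemma rhomology_dim_wedgeS k :
  rhomology_dim F (wedge K v) k.+1 = rhomology_dim F K k.
Proof.
rewrite /rhomology_dim /cycles /boundaries !chains_wedgeS.
have bN t : t \in base -> None \notin t by rewrite inE => /andP[].
have cap0 k' (X : {vspace chain V}) :
    (suspension v @: X :&: chains F base k' = 0)%VS.
  apply/eqP; rewrite -subv0 -(suspension_capv_chains v k' bN).
  by apply/capvS/subvv/limgS/subvf.
rewrite [LHS]hdim_add //.
- rewrite [X in (_ + X)%N](rhomology_dim_cone F k.+1 base_cone) addn0.
  apply: (hdim_img (a := -1)) => [||c].
  + by apply/lker0P; apply: can_inj (None_part_suspension v).
  + by rewrite oppr_eq0 oner_neq0.
  + by rewrite boundary_suspension scaleN1r.
- exact: cap0.
(* The boundary preserves both summands, so the images are disjoint by the same argument one degree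
   lower. *)
- apply/eqP; rewrite -subv0 -(cap0 k (boundary F V @: chains F K k)%VS).
  apply: capvS; last exact: subv_trans (boundary_chains F k down_closed_base) (capvSl _ _).
  apply/subvP => _ /memv_imgP[_ /memv_imgP[c cK ->] ->].
  by rewrite boundary_suspension memvN !memv_img.
- apply/subvP => _ /memv_imgP[_ /memv_imgP[c cK ->] ->].
  rewrite memv_cap memv_ker boundary_boundary eqxx andbT.
  rewrite boundary_suspension memvN memv_img //.
  by have /subvP/(_ _ (memv_img _ cK))/memv_capP[] := boundary_chains F k dK.
- exact: boundary_chains down_closed_base.
Qed.

(** The shift leaves out the degree of the empty face. There the empty face is the boundary of the
    vertex [v'], which belongs to K(v) as soon as the empty face does. *)
Lemma rhomology_dim_wedge0 : rhomology_dim F (wedge K v) 0 = 0%N.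
Proof.
apply: (hdim_contractible (boundary_cone (Some v))); apply: limg_chains_sub => t tK.
move/eqP; rewrite cards_eq0 => /eqP t0; rewrite t0 -(imset0 Some) in tK *.
rewrite face_extE mem_imset_Some inE -imsetU1; apply/memvZ/mem_chains.
  rewrite mem_wedge_Some // setU0 setDv; move: tK.
  by rewrite mem_wedge_Some // set0D.
by rewrite card_imset_Some setU0 cards1.
Qed.

End WedgeHomology.

End Suspension.

(** * Full subcomplexes of K(v) and Hochster's sum *)

Lemma mem_full (V : finType) (K : {set {set V}}) (J s : {set V}) :
  (s \in full_subcomplex K J) = (s \in K) && (s \subset J).
Proof. by rewrite inE. Qed.

Section BettiSum.

Variables (F : fieldType) (V : finType) (K : {set {set V}}) (v : V).
Implicit Types (J s : {set V}).
Hypothesis dK : down_closed K.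

Lemma down_closed_full J : down_closed (full_subcomplex K J).
Proof.
move=> s t; rewrite !inE => /andP[sK sJ] ts.
by rewrite (dK sK ts) (subset_trans ts sJ).
Qed.

Lemma full_wedge_Some J : v \notin J ->
  full_subcomplex (wedge K v) (Some @: J) = wedge_lift (full_subcomplex K J).
Proof.
move=> vJ; apply/setP => t; rewrite inE; case/option_setP: t => s.
  rewrite mem_wedge_Some // imset_Some_sub mem_imset ?inE; last exact/imset_inj/Some_inj.
  apply: andb_id2r => sJ; rewrite (setDidPl _) // disjoint_sym disjoints1.
  exact: contra (subsetP sJ v) vJ.
rewrite setU1_None_sub_imset andbF; apply/esym/imsetP => -[s' _ ss'].
by have := setU11 None (Some @: s); rewrite ss' (negPf (None_notin_imset _)).
Qed.

Lemma full_wedge_None J : v \in J ->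
  full_subcomplex (wedge K v) (None |: Some @: J) = wedge (full_subcomplex K J) v.
Proof.
move=> vJ; apply/setP => t; rewrite inE.
have dKJ := @down_closed_full J; case/option_setP: t => s.
  rewrite !mem_wedge_Some // imset_Some_subU1 inE; congr (_ && _).
  (* As [v] is in [J], removing it from [s] does not affect inclusion in [J]. *)
  by rewrite subDset (setUidPr _) // sub1set.
by rewrite !mem_wedge_None // setU1_None_sub inE.
Qed.

Lemma rhomology_full_wedge_Some J k : v \in J ->
  rhomology_dim F (full_subcomplex (wedge K v) (Some @: J)) k = 0%N.
Proof.
move=> vJ; apply: (@rhomology_dim_cone _ _ _ _ (Some v)) => t.
rewrite !mem_full; case/option_setP: t => s; last by rewrite setU1_None_sub_imset andbF.
rewrite -imsetU1 !mem_wedge_Some // !imset_Some_sub setDUl setDv set0U.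
by rewrite subUset sub1set vJ.
Qed.

(** A cone with apex [v'']: its faces avoid [v'], so those without [v''] come from faces of [K], to
    which [v''] can be added. *)
Lemma rhomology_full_wedge_None J k : v \notin J ->
  rhomology_dim F (full_subcomplex (wedge K v) (None |: Some @: J)) k = 0%N.
Proof.
move=> vJ; apply: (@rhomology_dim_cone _ _ _ _ None) => t.
rewrite !mem_full; case/option_setP: t => s; last by rewrite setU11.
rewrite mem_wedge_Some // mem_wedge_None // imset_Some_subU1 setU1_None_sub.
move=> /andP[+ sJ] _; rewrite sJ andbT (setDidPl _) //.
by rewrite disjoint_sym disjoints1; apply: contra (subsetP sJ v) vJ.
Qed.

Lemma Dtilde_wedge : Dtilde F (wedge K v) = Dtilde F K.
Proof.
rewrite /Dtilde sum_option_set; apply: eq_bigr => J _; rewrite card_option.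
have [vJ|vJ] := boolP (v \in J).
  rewrite big1 => [|k _]; last exact: rhomology_full_wedge_Some.
  (* The sum for K(v) has one degree more; here the bottom term vanishes and the shift matches the
     others. *)
  rewrite full_wedge_None // big_ord_recl rhomology_dim_wedge0; last exact: down_closed_full.
  rewrite !add0n; apply: eq_bigr => k _.
  by rewrite rhomology_dim_wedgeS //; apply: down_closed_full.
rewrite [X in (_ + X)%N]big1 => [|k _]; last exact: rhomology_full_wedge_None.
(* Without a shift the surplus term is the top one, beyond the number of vertices. *)
rewrite full_wedge_Some // big_ord_recr /= rhomology_dim_lift rhomology_dim_large //.
by rewrite !addn0; apply: eq_bigr => k _; rewrite rhomology_dim_lift.
Qed.

End BettiSum.

(** * Bounds on the minimal dimension of facets *)

Section MinimalDimension.

Variable V : finType.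
Implicit Types (K : {set {set V}}) (s : {set V}) (v : V).

Lemma mdim_le K s : is_facet K s -> (mdim K <= face_dim s)%N.
Proof.
move=> sK; rewrite /mdim -Order.NatOrder.minEnat -Order.NatOrder.leEnat.
exact: Order.TotalTheory.bigmin_le_cond.
Qed.

Lemma leq_mdim K n : set0 \in K ->
  (forall s, is_facet K s -> (n <= face_dim s)%N) -> (n <= mdim K)%N.
Proof.
move=> K0 nK; rewrite /mdim; elim/big_ind: _ => [|a b|s] //; last exact: nK.
  (* The default value of the minimum satisfies the bound too: some facet exists, and its dimension
     is at most [#|V|]. *)
  have [s sK _] := maxset_exists (P := fun t => t \in K) K0.
  apply: leq_trans (nK s sK) _; apply: leq_trans (leq_pred _) _.
  exact: max_card.
by rewrite leq_min => -> ->.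
Qed.

(** The vertex [v] prevents the empty face from being a facet, so the predecessor in [face_dim] does
    not truncate. *)
Lemma card_facet K v s : is_complex K -> is_facet K s ->
  #|s| = (face_dim s).+1.
Proof.
move=> [_ K1 _] /maxsetP[_ sK]; rewrite /face_dim prednK // card_gt0.
apply/eqP => s0; have := sK _ (K1 v); rewrite s0 sub0set => /(_ isT)/setP/(_ v).
by rewrite !inE eqxx.
Qed.

End MinimalDimension.

(** * Facets of K(v) *)

Section WedgeFacets.

Variables (V : finType) (K : {set {set V}}) (v : V).
Implicit Types s : {set V}.
Hypothesis hK : is_complex K.
Let dK : down_closed K. Proof. by case: hK. Qed.

Lemma is_facet_wedge_None s : is_facet (wedge K v) (None |: Some @: s) = is_facet K s.
Proof.
apply/maxsetP/maxsetP; rewrite mem_wedge_None // => -[sK sm]; split=> // t tK st.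
  by rewrite -[LHS]preimset_setU1_None (sm (None |: Some @: t)) ?preimset_setU1_None // ?mem_wedge_None ?setU1_None_sub.
case/option_setP: t tK st => t; first by rewrite setU1_None_sub_imset.
by rewrite mem_wedge_None // setU1_None_sub => tK st; rewrite (sm t).
Qed.

(** A face avoiding [v''] can always be enlarged by [v'], so a facet of this kind contains [v']. *)
Lemma is_facet_wedge_Some s : is_facet (wedge K v) (Some @: s) ->
  v \in s /\ is_facet K (s :\ v).
Proof.
case/maxsetP; rewrite mem_wedge_Some // => sK sm.
have vs : v \in s.
  rewrite -mem_imset_Some -(sm (Some @: (v |: s))) ?imset_Some_sub ?subsetU1 //.
    by rewrite mem_imset_Some setU11.
  by rewrite mem_wedge_Some // setDUl setDv set0U.
split=> //; apply/maxsetP; split=> // t tK st.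
(* Otherwise [v''] could be added to the facet. Hence a face of [K] above [s :\ v] cannot contain
   [v], and adding [v'] to it gives a face to compare with the facet. *)
have sNK : s \notin K.
  apply/negP => sK'; have := sm (None |: Some @: s).
  rewrite mem_wedge_None // imset_Some_subU1 subxx => /(_ sK' isT)/setP/(_ None).
  by rewrite setU11 (negPf (None_notin_imset _)).
have vt : v \notin t.
  apply: contra sNK => vt; apply: dK tK _.
  by rewrite -(setD1K vs) subUset sub1set vt.
have := sm (Some @: (v |: t)).
rewrite mem_wedge_Some // imset_Some_sub setU1K // -subDset st => /(_ tK isT).
by move/(imset_inj Some_inj) => <-; rewrite setU1K.
Qed.

Lemma mdim_wedge : mdim (wedge K v) = (mdim K).+1.
Proof.
have hW := wedge_complex v hK; have [K0 _ _] := hK; have [W0 _ _] := hW.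
apply/eqP; rewrite eqn_leq; apply/andP; split.
  case E : (mdim (wedge K v)) => [//|n]; rewrite ltnS; apply: leq_mdim => // s sK.
  (* Adding [v''] to the facet [s] gives a facet of dimension [#|s|]. *)
  rewrite -ltnS -E -(card_facet v hK sK) -[#|s|]/(#|s|.+1.-1) -card_setU1_None.
  by apply: mdim_le; rewrite is_facet_wedge_None.
apply: leq_mdim => // t; case/option_setP: t => s; rewrite /face_dim.
  case/is_facet_wedge_Some => vs sK; rewrite card_imset_Some (cardsD1 v) vs.
  by rewrite (card_facet v hK sK) ltnS mdim_le.
rewrite is_facet_wedge_None card_setU1_None => sK.
by rewrite /= (card_facet v hK sK) ltnS mdim_le.
Qed.

End WedgeFacets.

Theorem theorem8p3 (F : fieldType) (V : finType) (K : {set {set V}}) (v : V)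
    (hK : is_complex K) :
  weakly_taut F (wedge K v) <-> weakly_taut F K.
Proof.
have dK : down_closed K by case: hK.
(* The number of vertices and [mdim] both grow by one, which leaves the exponent unchanged. *)
by rewrite /weakly_taut Dtilde_wedge // mdim_wedge // card_option subSS.
Qed.
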